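(* (i) Let $\Gamma$ be a subgroup of $\mathbb{C}\times\mathbb{Z}_2$ and $\alpha\in\mathbb{C}$. If $\tilde f\in\Gamma^\vee$ extends to $f\in(\mathbb{C}\times\mathbb{Z}_2)^\vee$, then, as $s\mathcal{W}_\Gamma$-modules, $$W(s\Omega_\Gamma(\tilde f,\alpha))\cong sV_{\mathbb{C}}(1-\alpha).$$ (ii) For $\alpha\in\mathbb{C}$, the $s\mathcal{W}_{\mathbb{C}}$-module $sV_{\mathbb{C}}(\alpha)$ is simple if and only if $\alpha\neq 1/2,1$. The $s\mathcal{W}_{\mathbb{C}}$-module $sV_{\mathbb{C}}(1/2)$ has a unique nonzero proper submodule $\mathbb{C}w_0$, and the module $sV_{\mathbb{C}}(1)$ has a unique nonzero proper submodule $\bigoplus_{k\in\mathbb{C}^*}\mathbb{C}v_k$.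
   Context: The base field is $\mathbb{C}$. $\Gamma^\vee$ is the set of group homomorphisms $\Gamma\to\mathbb{C}^*$. For a subgroup $\Gamma\subset\mathbb{C}\times\mathbb{Z}_2$: $\Gamma_0=\{x\mid(x,0)\in\Gamma\}$, $\Gamma_1=\{x\mid(x,1)\in\Gamma\}$; for $f\in\Gamma^\vee$, $m\in\Gamma_0$, $r\in\Gamma_1$ write $f(m)=f((m,0))$, $f(r)=f((r,1))$. $s\mathcal{W}_\Gamma$ is the Lie superalgebra with even basis $\{L_m\}_{m\in\Gamma_0}$, odd basis $\{G_r\}_{r\in\Gamma_1}$, $[L_m,L_n]=(m-n)L_{m+n}$, $[L_m,G_r]=(\tfrac m2-r)G_{m+r}$, $[G_r,G_s]=2L_{r+s}$. $s\mathcal{W}_{\mathbb{C}}$ denotes the case $\Gamma=\mathbb{C}\times\mathbb{Z}_2$. Modules and submodules are $\mathbb{Z}_2$-graded. $s\Omega_\Gamma(f,\alpha)$ is $\mathbb{C}[L_0]\oplus\xi\mathbb{C}[L_0]$ (first summand even, second odd) with $$L_m(P(L_0)+\xi Q(L_0))=f(m)(L_0+m\alpha)P(L_0+m)+f(m)(L_0+m(\alpha+\tfrac12))\,\xi Q(L_0+m),$$ $$G_r(P(L_0)+\xi Q(L_0))=f(r)(L_0+2r\alpha)Q(L_0+r)+f(r)\,\xi P(L_0+r),$$ where $p(L_0)\xi q(L_0)$ means $\xi p(L_0)q(L_0)$. Super intermediate series module: for $a\in\mathbb{C}$, $sV_{\mathbb{C}}(a)$ is the $s\mathcal{W}_\Gamma$-module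 with basis $\{v_k\}_{k\in\mathbb{C}}$ of the even part, $\{w_k\}_{k\in\mathbb{C}}$ of the odd part, and for $m\in\Gamma_0$, $r\in\Gamma_1$: $L_mv_k=(k-am)v_{k-m}$, $L_mw_j=(j-(a-\tfrac12)m)w_{j-m}$, $G_rv_k=w_{k-r}$, $G_rw_j=(j-2r(a-\tfrac12))v_{j-r}$. Weighting functor: let $\mathfrak g$ be a Lie superalgebra and $\mathfrak h\subset\mathfrak g$ a commutative subalgebra acting diagonally on $\mathfrak g$ by the adjoint action, $\mathfrak g=\bigoplus_{\mu\in\mathfrak h^*}\mathfrak g_\mu$. Each $\mu\in\mathfrak h^*$ induces an algebra homomorphism $\overline\mu:\mathcal{U}(\mathfrak h)\to\mathbb{C}$. For a $\mathfrak g$-module $M$ put $W(M)=\bigoplus_{\mu\in\mathfrak h^*}M/\ker(\overline\mu)M$, with $x\in\mathfrak g_\beta$ acting by $x(v+\ker(\overline\mu)M)=xv+\ker(\overline{\mu+\beta})M$; this is a $\mathfrak g$-module. For $\mathfrak g=s\mathcal{W}_\Gamma$ one takes $\mathfrak h=\mathbb{C}L_0$.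
   Formalization: As printed, ⊕_{k≠0} C v_k is not a submodule of sV_C(1), since G_r v_k = w_{k-r} is nonzero and odd; the formal statement instead takes the unique nonzero proper submodule to be ⊕_{k≠0} C v_k ⊕ ⊕_{k∈C} C w_k. *)

(* Defs.v *)
From HB Require Import structures.
From mathcomp Require Import all_boot all_order all_algebra finmap.
From mathcomp Require Import boolp classical_sets reals complex monalg ring.

Set Implicit Arguments.
Unset Strict Implicit.
Unset Printing Implicit Defensive.

Import GRing.Theory Num.Theory.

Local Open Scope classical_set_scope.
Local Open Scope ring_scope.

Lemma Z2P (i : 'Z_2) : i = 0 \/ i = 1.
Proof. by case: i => [[|[|i]] hi] //; [left|right]; exact: val_inj. Qed.

Definition lspan (F : fieldType) (V : lmodType F) (A : set V) : set V :=
  [set v | exists s : seq (F * V),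
     (forall p, p \in s -> A p.2) /\ v = \sum_(p <- s) p.1 *: p.2].

Record superspace (F : fieldType) := SuperSpace {
  carrier :> lmodType F;
  part : 'Z_2 -> set carrier;
  part_0 : forall i, part i 0;
  part_lin : forall i c u v, part i u -> part i v -> part i (c *: u + v);
  part_dec : forall v, exists! p : carrier * carrier,
    [/\ part 0 p.1, part 1 p.2 & v = p.1 + p.2] }.

Record lieSuperalgebra (F : fieldType) := LieSuperalgebra {
  lie_space :> superspace F;
  brk : lie_space -> lie_space -> lie_space;
  brk_linl : forall y, linear (brk^~ y);
  brk_linr : forall x, linear (brk x);
  brk_part : forall i j x y, part i x -> part j y -> part (i + j) (brk x y);
  brk_anti : forall i j x y, @part _ lie_space i x -> @part _ lie_space j y ->
    brk x y = - ((-1) ^+ (i * j)%N *: brk y x);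
  brk_jacobi : forall i j x y z,
    @part _ lie_space i x -> @part _ lie_space j y ->
    brk x (brk y z) = brk (brk x y) z + (-1) ^+ (i * j)%N *: brk y (brk x z) }.

Record supermodule (F : fieldType) (g : lieSuperalgebra F) := SuperModule {
  mod_space :> superspace F;
  act : g -> mod_space -> mod_space;
  act_linl : forall v, linear (act^~ v);
  act_linr : forall x, linear (act x);
  act_part : forall i j x v, part i x -> part j v -> part (i + j) (act x v);
  act_brk : forall i j x y v, @part _ g i x -> @part _ g j y ->
    act (brk x y) v = act x (act y v) - (-1) ^+ (i * j)%N *: act y (act x v) }.

Section ModuleNotions.
Variables (F : fieldType) (g : lieSuperalgebra F).

Definition module_iso (M N : supermodule g) : Prop :=
  exists f : {linear M -> N},
    [/\ bijective f,
        forall i v, @part _ M i v -> @part _ N i (f v)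
      & forall (x : g) (v : M), f (act x v) = act x (f v)].

Definition graded_submodule (M : supermodule g) (N : set M) : Prop :=
  [/\ N 0,
      forall (c : F) (u v : M), N u -> N v -> N (c *: u + v),
      forall u v : M, @part _ M 0 u -> @part _ M 1 v -> N (u + v) -> N u /\ N v
    & forall (x : g) (v : M), N v -> N (act x v)].

Definition simple_module (M : supermodule g) : Prop :=
  (exists v : M, v <> 0) /\
  forall N : set M, graded_submodule N -> N = [set 0] \/ N = [set: M].

Definition unique_proper_submodule (M : supermodule g) (N0 : set M) : Prop :=
  forall N : set M,
    [/\ graded_submodule N, N <> [set 0] & N <> [set: M]] <-> N = N0.

End ModuleNotions.
Arguments graded_submodule {F g} M N.
Arguments unique_proper_submodule {F g} M N0.

Lemma linear_f0 (F : fieldType) (U V : lmodType F) (f : U -> V) : linear f -> f 0 = 0.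
Proof. by move=> lf; have := lf (-1) 0 0; rewrite scaler0 addr0 scaleN1r addNr. Qed.

Lemma linear_fZ (F : fieldType) (U V : lmodType F) (f : U -> V) c u :
  linear f -> f (c *: u) = c *: f u.
Proof. by move=> lf; have := lf c u 0; rewrite (linear_f0 lf) !addr0. Qed.

Lemma linear_fD (F : fieldType) (U V : lmodType F) (f : U -> V) u v :
  linear f -> f (u + v) = f u + f v.
Proof. by move=> lf; have := lf 1 u v; rewrite !scale1r. Qed.

Lemma linear_fB (F : fieldType) (U V : lmodType F) (f : U -> V) u v :
  linear f -> f (u - v) = f u - f v.
Proof. by move=> lf; rewrite addrC -scaleN1r lf scaleN1r addrC. Qed.

(* naming the lmodType instance keeps unification on {malg F[K]} tractable *)
Definition freeMod (F : fieldType) (K : choiceType) : lmodType F := {malg F[K]}.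

Definition basis (F : fieldType) (K : choiceType) (k : K) : freeMod F K := << k >>.
Arguments basis {F K}.

Section FreeModule.
Variables (F : fieldType) (K : choiceType).
Implicit Types (x y : freeMod F K) (k : K).

Lemma fcoefD x y k : (x + y)@_k = x@_k + y@_k.
Proof. exact: mcoeffD. Qed.

Lemma fcoefB x y k : (x - y)@_k = x@_k - y@_k.
Proof. exact: mcoeffB. Qed.

Lemma fcoefZ c x k : (c *: x)@_k = c * x@_k.
Proof. exact: mcoeffZ. Qed.

Lemma fcoef0 k : (0 : freeMod F K)@_k = 0.
Proof. exact: mcoeff0. Qed.

Lemma fcoefU k l : (basis k : freeMod F K)@_l = (k == l)%:R.
Proof. exact: mcoeffU. Qed.

Lemma freeE x : x = \sum_(k <- msupp x) x@_k *: basis k.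
Proof.
rewrite {1}[x]monalgE; apply: eq_bigr => k _.
by apply/malgP => l; rewrite fcoefZ fcoefU mcoeffU mulr_natr.
Qed.

Lemma msuppB k : msupp (basis k : freeMod F K) = [fset k]%fset.
Proof. by rewrite /basis msuppU oner_eq0. Qed.

End FreeModule.

Section LinearExtension.
Variables (F : fieldType) (K : choiceType) (V : lmodType F).
Implicit Types (phi : K -> V) (x : freeMod F K).

Definition mext phi x : V := \sum_(k <- msupp x) x@_k *: phi k.

Lemma mextEw phi x (d : {fset K}) : (msupp x `<=` d)%fset ->
  mext phi x = \sum_(k <- d) x@_k *: phi k.
Proof.
move=> le_d; rewrite /mext (big_fset_incl _ le_d) //= => k _ kx.
by rewrite mcoeff_outdom // scale0r.
Qed.

Lemma mext_linear phi : linear (mext phi).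
Proof.
move=> c x y; pose d := (msupp x `|` msupp y `|` msupp (c *: x + y))%fset.
have [dx dy dxy] : [/\ (msupp x `<=` d)%fset, (msupp y `<=` d)%fset
    & (msupp (c *: x + y) `<=` d)%fset].
  by split; apply/fsubsetP => k; rewrite !inE => ->; rewrite ?orbT.
rewrite (mextEw _ dx) (mextEw _ dy) (mextEw _ dxy).
rewrite scaler_sumr -big_split /=; apply: eq_bigr => k _.
by rewrite fcoefD fcoefZ scalerDl scalerA.
Qed.

Lemma mextU phi k : mext phi (basis k) = phi k.
Proof.
by rewrite /mext msuppB big_seq_fset1 fcoefU eqxx scale1r.
Qed.

Lemma mext_linphi (phi psi : K -> V) c x :
  mext (fun k => c *: phi k + psi k) x = c *: mext phi x + mext psi x.
Proof.
rewrite /mext scaler_sumr -big_split /=; apply: eq_bigr => k _.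
by rewrite scalerDr !scalerA mulrC.
Qed.

End LinearExtension.

Section FreeSuperspace.
Variables (F : fieldType) (K : choiceType) (deg : K -> 'Z_2).
Implicit Types (x : freeMod F K).

Definition free_part (i : 'Z_2) : set (freeMod F K) :=
  [set x | forall k, k \in msupp x -> deg k = i].

Lemma malg_supp_ind (P : freeMod F K -> Prop) :
  P 0 -> (forall c x y, P x -> P y -> P (c *: x + y)) ->
  forall x, (forall k, k \in msupp x -> P (basis k)) -> P x.
Proof.
move=> P0 PD x Px; rewrite [x]freeE big_seq.
apply: (big_ind P) => //.
  by move=> u v Pu Pv; rewrite -[u]scale1r; apply: PD.
by move=> k kx; rewrite -[_ *: _]addr0; apply: PD => //; apply: Px.
Qed.

Lemma malg_lin_ind (P : freeMod F K -> Prop) :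
  P 0 -> (forall c x y, P x -> P y -> P (c *: x + y)) ->
  (forall k, P (basis k)) -> forall x, P x.
Proof. by move=> P0 PD PU x; apply: malg_supp_ind. Qed.

Lemma free_part_ind i (P : freeMod F K -> Prop) :
  P 0 -> (forall c x y, P x -> P y -> P (c *: x + y)) ->
  (forall k, deg k = i -> P (basis k)) ->
  forall x, free_part i x -> P x.
Proof. by move=> P0 PD PU x xi; apply: malg_supp_ind => // k /xi /PU. Qed.

Lemma free_partP i x : free_part i x <-> (forall k, deg k != i -> x@_k = 0).
Proof.
split=> [xi k ki|xi k].
  by apply: mcoeff_outdom; apply: contra ki => /xi ->.
by rewrite -mcoeff_neq0 => xk; apply/eqP; apply: contraNT xk => /xi ->.
Qed.

Lemma free_part_0 i : free_part i 0.
Proof. by apply/free_partP => k _; rewrite fcoef0. Qed.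

Lemma free_part_lin i c x y :
  free_part i x -> free_part i y -> free_part i (c *: x + y).
Proof.
move=> /free_partP xi /free_partP yi; apply/free_partP => k ki.
by rewrite fcoefD fcoefZ xi // yi // mulr0 addr0.
Qed.

Lemma free_partU k : free_part (deg k) (basis k).
Proof. by move=> l; rewrite msuppB in_fset1 => /eqP ->. Qed.

Lemma free_part_dec x : exists! p : freeMod F K * freeMod F K,
  [/\ free_part 0 p.1, free_part 1 p.2 & x = p.1 + p.2].
Proof.
pose x0 : freeMod F K := [malg k in msupp x => if deg k == 0 then x@_k else 0].
have x0E k : x0@_k = if deg k == 0 then x@_k else 0.
  by rewrite mcoeffE; case: msuppP => // _; rewrite if_same.
exists (x0, x - x0); split.
  split=> /=; last by rewrite addrC subrK.
  - by apply/free_partP => k /negPf k0; rewrite x0E k0.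
  - apply/free_partP => k k1; rewrite fcoefB x0E.
    by case: (Z2P (deg k)) k1 => ->; rewrite ?eqxx ?subrr.
move=> [u v] /= [/free_partP u0 /free_partP v1 xE].
have ux : x0 = u.
  apply/malgP => k; rewrite x0E xE fcoefD; case: ifPn => [/eqP dk|/u0 -> //].
  by rewrite [v@_k]v1 ?addr0 // dk.
by rewrite ux; congr pair; rewrite xE addrC addKr.
Qed.

Definition free_superspace : superspace F :=
  @SuperSpace F (freeMod F K) free_part free_part_0 free_part_lin free_part_dec.

End FreeSuperspace.

Definition wt (F : fieldType) : zmodType := (F * 'Z_2)%type.

(* In what follows io is the inclusion of the group Gamma = Gm in F x Z/2: an
   element s with io s = (x, 0) is an x in Gamma_0, and io s = (x, 1) is an x in
   Gamma_1. *)

Section SuperWitt.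
Variables (F : numFieldType) (Gm : zmodType) (io : {additive Gm -> wt F}).
Implicit Types (x y z : freeMod F Gm) (s t : Gm).

Definition gen (s : Gm) : freeMod F Gm := basis s.

Definition gdeg (s : Gm) : 'Z_2 := (io s).2.
Lemma gdegD s t : gdeg (s + t) = gdeg s + gdeg t.
Proof. by rewrite /gdeg raddfD. Qed.

Definition sW_const (s t : wt F) : F :=
  if s.2 == 0 then
    if t.2 == 0 then s.1 - t.1 else s.1 / 2 - t.1
  else
    if t.2 == 0 then - (t.1 / 2 - s.1) else 2.

(* gen s is L_m if s = (m, 0) and G_r if s = (r, 1) *)
Definition sW_brk x y : freeMod F Gm :=
  mext (fun s => mext (fun t => sW_const (io s) (io t) *: gen (s + t)) y) x.

Lemma sW_brk_linl y : linear (sW_brk^~ y).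
Proof. exact: mext_linear. Qed.

Lemma sW_brk_linr x : linear (sW_brk x).
Proof.
move=> c y z.
pose phi w s := mext (fun t => sW_const (io s) (io t) *: gen (s + t)) w.
rewrite -[RHS](mext_linphi (phi y) (phi z) c x).
congr (mext _ x); apply/funext => s; exact: mext_linear.
Qed.

Lemma sW_brkU s t :
  sW_brk (gen s) (gen t) = sW_const (io s) (io t) *: gen (s + t).
Proof. by rewrite /sW_brk mextU mextU. Qed.

Lemma sW_brk_part i j x y : free_part gdeg i x -> free_part gdeg j y ->
  free_part gdeg (i + j) (sW_brk x y).
Proof.
move=> xi yj; move: x xi; apply: (free_part_ind (deg := gdeg)).
- by rewrite (linear_f0 (sW_brk_linl _)); apply: free_part_0.
- by move=> c u v; rewrite sW_brk_linl; apply: free_part_lin.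
move=> s <-; move: y yj; apply: (free_part_ind (deg := gdeg)).
- by rewrite (linear_f0 (sW_brk_linr _)); apply: free_part_0.
- by move=> c u v; rewrite sW_brk_linr; apply: free_part_lin.
move=> t <-; rewrite sW_brkU -[X in free_part _ _ X]addr0.
by apply: free_part_lin; [rewrite -gdegD; exact: free_partU | exact: free_part_0].
Qed.

Lemma sW_brk_anti i j x y : free_part gdeg i x -> free_part gdeg j y ->
  sW_brk x y = - ((-1) ^+ (i * j)%N *: sW_brk y x).
Proof.
move=> xi yj; move: x xi; apply: (free_part_ind (deg := gdeg)).
- by rewrite (linear_f0 (sW_brk_linl _)) (linear_f0 (sW_brk_linr _)) scaler0 oppr0.
- move=> c u v Hu Hv; rewrite sW_brk_linl sW_brk_linr Hu Hv scalerDr opprD.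
  by rewrite scalerN !scalerA mulrC.
move=> s <-; move: y yj; apply: (free_part_ind (deg := gdeg)).
- by rewrite (linear_f0 (sW_brk_linl _)) (linear_f0 (sW_brk_linr _)) scaler0 oppr0.
- move=> c u v Hu Hv; rewrite sW_brk_linl sW_brk_linr Hu Hv scalerDr opprD.
  by rewrite scalerN !scalerA mulrC.
move=> t <-; rewrite !sW_brkU scalerA -scaleNr [t + s]addrC; congr (_ *: _).
rewrite /gdeg /sW_const; case: (io s) (io t) => [m p] [n q] /=.
by case: (Z2P p) => ->; case: (Z2P q) => -> /=;
  rewrite ?expr0 ?expr1 ?mul1r ?mulN1r ?opprB ?opprK.
Qed.

Lemma sW_brk_jacobi i j x y z : free_part gdeg i x -> free_part gdeg j y ->
  sW_brk x (sW_brk y z) =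
  sW_brk (sW_brk x y) z + (-1) ^+ (i * j)%N *: sW_brk y (sW_brk x z).
Proof.
move=> xi yj; have bl u := linear_f0 (sW_brk_linl u).
have br u := linear_f0 (sW_brk_linr u).
move: x xi; apply: (free_part_ind (deg := gdeg)).
- by rewrite !(bl, br) scaler0 addr0.
- move=> c u v Hu Hv; rewrite !(sW_brk_linl, sW_brk_linr) Hu Hv.
  by rewrite !scalerDr !scalerA addrACA mulrC.
move=> s <-; move: y yj; apply: (free_part_ind (deg := gdeg)).
- by rewrite !(bl, br) scaler0 addr0.
- move=> c u v Hu Hv; rewrite !(sW_brk_linl, sW_brk_linr) Hu Hv.
  by rewrite !scalerDr !scalerA addrACA mulrC.
move=> t <-; move: z; apply: malg_lin_ind.
- by rewrite !(bl, br) scaler0 addr0.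
- move=> c u v Hu Hv; rewrite !(sW_brk_linl, sW_brk_linr) Hu Hv.
  by rewrite !scalerDr !scalerA addrACA mulrC.
move=> r; rewrite !sW_brkU !(linear_fZ _ _ (sW_brk_linl _)).
rewrite !(linear_fZ _ _ (sW_brk_linr _)) !sW_brkU !scalerA.
rewrite [t + (s + r)]addrCA -[s + t + r]addrA -scalerDl; congr (_ *: _).
rewrite /gdeg /sW_const !raddfD.
case: (io s) (io t) (io r) => [m p] [n q] [l k] /=.
by case: (Z2P p) => ->; case: (Z2P q) => ->; case: (Z2P k) => -> /=;
  rewrite ?expr0 ?expr1; field.
Qed.

Definition sW : lieSuperalgebra F :=
  @LieSuperalgebra F (free_superspace F gdeg) sW_brk sW_brk_linl sW_brk_linr
    sW_brk_part sW_brk_anti sW_brk_jacobi.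

Section ModuleOfOps.
Variables (V : superspace F) (op : Gm -> V -> V).
Hypothesis op_lin : forall s, linear (op s).
Hypothesis op_part : forall s j v, part j v -> part (gdeg s + j) (op s v).
Hypothesis op_rel : forall s t v, sW_const (io s) (io t) *: op (s + t) v =
  op s (op t v) - (-1) ^+ (gdeg s * gdeg t)%N *: op t (op s v).

Definition ops_act (x : sW) (v : V) : V := mext (op^~ v) x.

Lemma ops_act_linl v : linear (ops_act^~ v).
Proof. exact: mext_linear. Qed.

Lemma ops_act_linr x : linear (ops_act x).
Proof.
move=> c u v; rewrite -[RHS](mext_linphi (op^~ u) (op^~ v) c x).
congr (mext _ x); apply/funext => s; exact: op_lin.
Qed.

Lemma ops_actU s v : ops_act (gen s) v = op s v.
Proof. exact: mextU. Qed.

Lemma ops_act_part i j (x : sW) v :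
  part i x -> part j v -> part (i + j) (ops_act x v).
Proof.
move=> xi vj; move: x xi; apply: (free_part_ind (deg := gdeg)).
- by rewrite (linear_f0 (ops_act_linl _)); apply: part_0.
- by move=> c x y; rewrite ops_act_linl; apply: part_lin.
by move=> s <-; rewrite ops_actU; apply: op_part.
Qed.

Lemma ops_act_brk i j (x y : sW) v : @part _ sW i x -> @part _ sW j y ->
  ops_act (sW_brk x y) v =
  ops_act x (ops_act y v) - (-1) ^+ (i * j)%N *: ops_act y (ops_act x v).
Proof.
move=> xi yj; have al u := linear_f0 (ops_act_linl u).
have ar u := linear_f0 (ops_act_linr u).
move: x xi; apply: (free_part_ind (deg := gdeg)).
- by rewrite (linear_f0 (sW_brk_linl _)) !al ar scaler0 subr0.
- move=> c u w Hu Hw; rewrite sW_brk_linl !ops_act_linl Hu Hw ops_act_linr.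
  by rewrite !scalerDr !scalerN !scalerA opprD addrACA [_ * c]mulrC.
move=> s <-; move: y yj; apply: (free_part_ind (deg := gdeg)).
- by rewrite (linear_f0 (sW_brk_linr _)) !al ar scaler0 subr0.
- move=> c u w Hu Hw; rewrite sW_brk_linr !ops_act_linl Hu Hw ops_act_linr.
  by rewrite !scalerDr !scalerN !scalerA opprD addrACA [_ * c]mulrC.
move=> t <-; rewrite sW_brkU (linear_fZ _ _ (ops_act_linl _)) !ops_actU.
exact: op_rel.
Qed.

Definition module_of_ops : supermodule sW :=
  @SuperModule F sW V ops_act ops_act_linl ops_act_linr ops_act_part ops_act_brk.

End ModuleOfOps.

End SuperWitt.

Definition subgrp_def (V : zmodType) (G : zmodClosed V) : Type := {x : V | x \in G}.
HB.instance Definition _ (V : zmodType) (G : zmodClosed V) :=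
  SubChoice.on (subgrp_def G).
HB.instance Definition _ (V : zmodType) (G : zmodClosed V) :=
  [SubChoice_isSubZmodule of subgrp_def G by <:].

Definition subgrp (V : zmodType) (G : zmodClosed V) : zmodType := subgrp_def G.
Definition incl (V : zmodType) (G : zmodClosed V) : {additive subgrp G -> V} :=
  (val : subgrp_def G -> V).
Arguments incl {V} G.

Definition full_group (V : zmodType) : {pred V} := [pred x : V | true].
Arguments full_group : clear implicits.
Lemma full_group_zmod_closed (V : zmodType) : zmod_closed (full_group V).
Proof. by []. Qed.
HB.instance Definition _ (V : zmodType) :=
  GRing.isZmodClosed.Build V (full_group V) (full_group_zmod_closed V).

Record character (F : fieldType) (A : zmodType) := Character {
  chi :> A -> F;
  chi_neq0 : forall x, chi x != 0;
  chiD : forall x y, chi (x + y) = chi x * chi y }.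

Section OmegaModule.
Variables (F : numFieldType) (Gm : zmodType) (io : {additive Gm -> wt F}).
Variables (f : character F Gm) (a : F).

(* (P, Q) stands for P(L_0) + xi Q(L_0), with 'X for L_0 *)
Definition omega_space : lmodType F := ({poly F} * {poly F})%type.

Definition omega_part (i : 'Z_2) : set omega_space :=
  if i == 0 then [set v | v.2 = 0] else [set v | v.1 = 0].

Lemma omega_part_0 i : omega_part i 0.
Proof. by rewrite /omega_part; case: ifP. Qed.

Lemma omega_part_lin i c u v :
  omega_part i u -> omega_part i v -> omega_part i (c *: u + v).
Proof.
rewrite /omega_part; case: u v => [u1 u2] [v1 v2].
by case: ifP => _ /= -> ->; rewrite scaler0 addr0.
Qed.

Lemma omega_part_dec (v : omega_space) : exists! p : omega_space * omega_space,
  [/\ omega_part 0 p.1, omega_part 1 p.2 & v = p.1 + p.2].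
Proof.
case: v => P Q; exists ((P, 0), (0, Q)); split.
  by split=> //=; congr pair; rewrite ?addr0 ?add0r.
move=> [[u1 u2] [v1 v2]] []; rewrite /omega_part /= => -> -> [-> ->].
by rewrite addr0 add0r.
Qed.

Definition omega_super : superspace F :=
  @SuperSpace F omega_space omega_part omega_part_0 omega_part_lin
    omega_part_dec.

Definition omega_op (s : Gm) (v : omega_super) : omega_super :=
  let m := (io s).1 in let: (P, Q) := (v : {poly F} * {poly F}) in
  if gdeg io s == 0 then
    (f s *: (('X + (m * a)%:P) * (P \Po ('X + m%:P))),
     f s *: (('X + (m * (a + 1 / 2))%:P) * (Q \Po ('X + m%:P))))
  else
    (f s *: (('X + (2 * m * a)%:P) * (Q \Po ('X + m%:P))),
     f s *: (P \Po ('X + m%:P))).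

Lemma omega_op_lin s : linear (omega_op s).
Proof.
move=> c [P Q] [P' Q']; rewrite /omega_op.
by case: ifP => _ /=; congr pair => /=;
  rewrite comp_polyD comp_polyZ -!mul_polyC; ring.
Qed.

Lemma omega_op_part s j v : part j v -> part (gdeg io s + j) (omega_op s v).
Proof.
case: v => P Q; rewrite /= /omega_part /omega_op.
by case: (Z2P (gdeg io s)) (Z2P j) => -> [] -> /= ->;
  rewrite ?comp_poly0 ?mulr0 ?scaler0.
Qed.

Lemma omega_op_rel s t v : sW_const (io s) (io t) *: omega_op (s + t) v =
  omega_op s (omega_op t v) -
  (-1) ^+ (gdeg io s * gdeg io t)%N *: omega_op t (omega_op s v).
Proof.
case: v => P Q; rewrite /omega_op gdegD /sW_const raddfD -!/(gdeg io _).
have cA (m n : F) (p : {poly F}) :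
  (p \Po ('X + m%:P)) \Po ('X + n%:P) = p \Po ('X + (m + n)%:P).
  by rewrite -comp_polyA comp_polyD comp_polyX comp_polyC polyCD -addrA [n%:P + _]addrC.
have fst2 : (io s + io t).1 = (io s).1 + (io t).1 by [].
rewrite fst2; move: (io s).1 (io t).1 => m n; rewrite !chiD.
have half (r : F) : exists k, r = k + k by exists (r / 2); field.
have [k ->] := half m; have [l ->] := half n.
have h1 (r : F) : (r + r) / 2 = r by field.
have h2 (r : F) : (r + r) * (a + 1 / 2) = (r + r) * a + r by field.
have h3 (r r' : F) :
  (r + r + (r' + r')) * (a + 1 / 2) = (r + r + (r' + r')) * a + r + r' by field.
have e1 : ((1 : 'Z_2) == 0) = false by [].
have e2 : (1 + 1 : 'Z_2) == 0 by [].
case: (Z2P (gdeg io s)) => ->; case: (Z2P (gdeg io t)) => ->;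
  rewrite ?addr0 ?add0r ?e1 ?e2 ?eqxx ?h1 ?h2 ?h3 ?expr0 ?expr1 ?scale1r ?scaleN1r.
all: congr pair => /=.
all: rewrite ?(comp_polyZ, comp_polyM, comp_polyD, comp_polyX, comp_polyC) ?cA ?[l + l + (k + k)]addrC.
all: rewrite -!mul_polyC ?(polyCD, polyCM, polyCN, polyC1, polyC_natr).
all: ring.
Qed.

Definition sOmega : supermodule (sW io) :=
  module_of_ops omega_op_lin omega_op_part omega_op_rel.

End OmegaModule.

Section IntermediateSeries.
Variables (F : numFieldType) (Gm : zmodType) (io : {additive Gm -> wt F}).
Variable a : F.

(* sV(a) is free on the pairs: basis (k, 0) is v_k and basis (k, 1) is w_k *)
Definition sV_deg (k : wt F) : 'Z_2 := k.2.

Definition sV_super : superspace F := free_superspace F sV_deg.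

Definition sV_v (k : F) : sV_super := basis ((k, 0) : wt F).
Definition sV_w (k : F) : sV_super := basis ((k, 1) : wt F).

Definition sV_coef (s k : wt F) : F :=
  if s.2 == 0 then
    if k.2 == 0 then k.1 - a * s.1 else k.1 - (a - 1 / 2) * s.1
  else
    if k.2 == 0 then 1 else k.1 - 2 * s.1 * (a - 1 / 2).

Definition sV_shift (s k : wt F) : wt F := (k.1 - s.1, s.2 + k.2).

Definition sV_op_basis (s : Gm) (k : wt F) : sV_super :=
  sV_coef (io s) k *: (basis (sV_shift (io s) k) : sV_super).

Definition sV_op (s : Gm) (v : sV_super) : sV_super := mext (sV_op_basis s) v.

Lemma sV_op_lin s : linear (sV_op s).
Proof. exact: mext_linear. Qed.

Lemma sV_opU s k : sV_op s (basis k) = sV_op_basis s k.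
Proof. exact: mextU. Qed.

Lemma sV_op_part s j v : part j v -> part (gdeg io s + j) (sV_op s v).
Proof.
move=> vj; move: v vj; apply: (free_part_ind (deg := sV_deg)).
- by rewrite (linear_f0 (sV_op_lin _)); apply: part_0.
- by move=> c u v; rewrite sV_op_lin; apply: part_lin.
move=> k <-; rewrite sV_opU -[sV_op_basis s k]addr0.
by apply: part_lin (part_0 _ _); apply: (free_partU sV_deg).
Qed.

Lemma sV_op_rel s t v : sW_const (io s) (io t) *: sV_op (s + t) v =
  sV_op s (sV_op t v) -
  (-1) ^+ (gdeg io s * gdeg io t)%N *: sV_op t (sV_op s v).
Proof.
have o0 r := linear_f0 (sV_op_lin r).
move: v; apply: malg_lin_ind.
- by rewrite !o0 !scaler0 subr0.
- move=> c u v Hu Hv; rewrite !sV_op_lin scalerDr scalerA.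
  rewrite [_ * c]mulrC -scalerA Hu Hv !scalerDr !scalerN !scalerA opprD addrACA.
  by rewrite [_ * c]mulrC.
move=> k; rewrite !sV_opU /sV_op_basis !(linear_fZ _ _ (sV_op_lin _)) !sV_opU.
rewrite /sV_op_basis !scalerA raddfD.
have -> : sV_shift (io s) (sV_shift (io t) k) = sV_shift (io s + io t) k.
  by rewrite /sV_shift /= opprD [in LHS]addrAC !addrA.
have -> : sV_shift (io t) (sV_shift (io s) k) = sV_shift (io s + io t) k.
  by rewrite /sV_shift /= opprD !addrA [_.2 + _.2]addrC.
rewrite -scalerBl; congr (_ *: _).
rewrite /gdeg /sW_const /sV_coef /sV_shift /=.
case: (io s) (io t) k => [m p] [n q] [k r] /=.
by case: (Z2P p) => ->; case: (Z2P q) => ->; case: (Z2P r) => -> /=;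
  rewrite ?expr0 ?expr1; field.
Qed.

Definition sV : supermodule (sW io) :=
  module_of_ops sV_op_lin sV_op_part sV_op_rel.

End IntermediateSeries.

Section QuotientSpace.
Variables (F : fieldType) (V : lmodType F) (S : submodClosed V).
Local Open Scope quotient_scope.

Definition submod_pred : {pred V} := [pred v | v \in S].

Lemma submod_pred_zmod_closed : zmod_closed submod_pred.
Proof. exact/GRing.submod_closedB/submodClosedP. Qed.

HB.instance Definition _ :=
  GRing.isZmodClosed.Build V submod_pred submod_pred_zmod_closed.

Local Notation Q := (@Quotient.quot V submod_pred).

Definition quot_scale (c : F) (q : Q) : Q :=
  \pi_Q (c *: repr q).

Lemma quot_scale_pi c v :
  quot_scale c (\pi_Q v) = \pi_Q (c *: v).
Proof.
have : repr (\pi_Q v) - v \in submod_pred by rewrite Quotient.idealrBE reprK.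
rewrite inE => /(rpredZ c); rewrite scalerBr => H.
by apply/eqP; rewrite -Quotient.idealrBE inE.
Qed.

Lemma quot_scaleA c d q : quot_scale c (quot_scale d q) = quot_scale (c * d) q.
Proof.
by rewrite -[q]reprK [quot_scale d _]quot_scale_pi !quot_scale_pi scalerA.
Qed.

Lemma quot_scale1 : left_id 1 quot_scale.
Proof. by move=> q; rewrite -[q]reprK quot_scale_pi scale1r. Qed.

Lemma quot_scaleDr : right_distributive quot_scale +%R.
Proof.
move=> c p q; rewrite -[p]reprK -[q]reprK.
move: (repr p) (repr q) => u v.
by rewrite -raddfD !quot_scale_pi -raddfD scalerDr.
Qed.

Lemma quot_scaleDl q : {morph quot_scale^~ q : c d / c + d}.
Proof. by move=> c d /=; rewrite -[q]reprK !quot_scale_pi scalerDl raddfD. Qed.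

HB.instance Definition _ := GRing.Zmodule_isLmodule.Build F Q
  quot_scaleA quot_scale1 quot_scaleDr quot_scaleDl.

Definition quot_space : lmodType F := Q.

Definition quot_cls (v : V) : quot_space := \pi_Q v.

Definition quot_repr (q : quot_space) : V := repr (q : Q).

Lemma quot_reprK q : quot_cls (quot_repr q) = q.
Proof. exact: reprK. Qed.

Lemma quot_cls_lin : linear quot_cls.
Proof.
move=> c u v; rewrite /quot_cls raddfD; congr (_ + _).
exact/esym/quot_scale_pi.
Qed.

Lemma quot_cls_eq u v : quot_cls u = quot_cls v <-> u - v \in S.
Proof.
have -> : (u - v \in S) = (u - v \in submod_pred) by rewrite inE.
by rewrite Quotient.idealrBE; split => /eqP.
Qed.

End QuotientSpace.

Section DirectSum.
Variables (F : fieldType) (I : eqType) (T : I -> lmodType F).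

Record dsum := DSum {
  dval :> forall i, T i;
  dval_fin : exists s : seq I, forall i, i \notin s -> dval i = 0 }.

Lemma dsumP (u v : dsum) : (forall i, u i = v i) -> u = v.
Proof.
case: u v => [u hu] [v hv] /= uv.
have uvE : u = v by apply: functional_extensionality_dep.
by subst v; congr DSum; apply: Prop_irrelevance.
Qed.

HB.instance Definition _ := gen_eqMixin dsum.
HB.instance Definition _ := gen_choiceMixin dsum.

Definition dsum0 : dsum.
Proof. by exists (fun _ => 0); exists [::]. Defined.

Definition dsum_opp (u : dsum) : dsum.
Proof.
exists (fun i => - u i); case: (dval_fin u) => s hs; exists s => i /hs ->.
exact: oppr0.
Defined.

Definition dsum_add (u v : dsum) : dsum.
Proof.
exists (fun i => u i + v i).
case: (dval_fin u) (dval_fin v) => s hs [t ht]; exists (s ++ t) => i.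
by rewrite mem_cat negb_or => /andP[/hs -> /ht ->]; rewrite addr0.
Defined.

Definition dsum_scale (c : F) (u : dsum) : dsum.
Proof.
exists (fun i => c *: u i); case: (dval_fin u) => s hs; exists s => i /hs ->.
exact: scaler0.
Defined.

Lemma dsum_addA : associative dsum_add.
Proof. by move=> u v w; apply: dsumP => i; apply: addrA. Qed.

Lemma dsum_addC : commutative dsum_add.
Proof. by move=> u v; apply: dsumP => i; apply: addrC. Qed.

Lemma dsum_add0 : left_id dsum0 dsum_add.
Proof. by move=> u; apply: dsumP => i; apply: add0r. Qed.

Lemma dsum_addN : left_inverse dsum0 dsum_opp dsum_add.
Proof. by move=> u; apply: dsumP => i; apply: addNr. Qed.

HB.instance Definition _ :=
  GRing.isZmodule.Build dsum dsum_addA dsum_addC dsum_add0 dsum_addN.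

Lemma dsum_scaleA c d u : dsum_scale c (dsum_scale d u) = dsum_scale (c * d) u.
Proof. by apply: dsumP => i; apply: scalerA. Qed.

Lemma dsum_scale1 : left_id 1 dsum_scale.
Proof. by move=> u; apply: dsumP => i; apply: scale1r. Qed.

Lemma dsum_scaleDr : right_distributive dsum_scale +%R.
Proof. by move=> c u v; apply: dsumP => i; apply: scalerDr. Qed.

Lemma dsum_scaleDl u : {morph dsum_scale^~ u : c d / c + d}.
Proof. by move=> c d; apply: dsumP => i; apply: scalerDl. Qed.

HB.instance Definition _ := GRing.Zmodule_isLmodule.Build F dsum
  dsum_scaleA dsum_scale1 dsum_scaleDr dsum_scaleDl.

Definition direct_sum : lmodType F := dsum.

Lemma dsumZD c (u v : direct_sum) i :
  (c *: u + v : direct_sum) i = c *: (u : dsum) i + (v : dsum) i.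
Proof. by []. Qed.

End DirectSum.

Section SpanTheory.
Variables (F : fieldType) (V : lmodType F) (A : set V).

Lemma lspan_sub v : A v -> lspan A v.
Proof.
move=> Av; exists [:: (1, v)]; rewrite big_seq1 scale1r; split=> // p.
by rewrite inE => /eqP ->.
Qed.

Lemma lspan_0 : lspan A 0.
Proof. by exists [::]; rewrite big_nil. Qed.

Lemma lspan_lin c u v : lspan A u -> lspan A v -> lspan A (c *: u + v).
Proof.
move=> [s [sA ->]] [t [tA ->]].
exists ([seq (c * p.1, p.2) | p <- s] ++ t); split.
  by move=> p; rewrite mem_cat => /orP[/mapP[q /sA Aq ->] //|/tA].
rewrite big_cat big_map scaler_sumr; congr (_ + _).
by apply: eq_bigr => p _; rewrite scalerA.
Qed.

Lemma lspan_min (B : set V) : B 0 ->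
  (forall c u v, B u -> B v -> B (c *: u + v)) -> A `<=` B -> lspan A `<=` B.
Proof.
move=> B0 BD AB v [s [sA ->]]; elim: s sA => [|p s IH] sA.
  by rewrite big_nil.
rewrite big_cons; apply: BD; first by apply/AB/sA; rewrite mem_head.
by apply: IH => q qs; apply: sA; rewrite inE qs orbT.
Qed.

End SpanTheory.

Section Weighting.
Variables (F : numFieldType) (Gm : zmodType) (io : {additive Gm -> wt F}).
Variable M : supermodule (sW io).
Implicit Types (s t : Gm) (u v : M) (mu nu : F).

(* h is the line spanned by L_0: U(h) = F[L_0] is {poly F}, a weight mu in the
   dual of h is identified with mu(L_0), and p |-> p.[mu] is the morphism
   U(h) -> F that it induces *)
Definition L0 : sW io := gen F (0 : Gm).

Definition poly_act (p : {poly F}) v : M :=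
  \sum_(i < size p) p`_i *: iter i (act L0) v.

Definition ker_weight mu : set M :=
  lspan [set w : M | exists p v, p.[mu] = 0 /\ w = poly_act p v].

Lemma ker_weightE mu w :
  ker_weight mu w <-> exists v, w = act L0 v - mu *: v.
Proof.
have lL := act_linr L0 : linear (act L0 : M -> M).
pose B : set M := [set w | exists v, w = act L0 v - mu *: v].
have B0 : B 0 by exists 0; rewrite (linear_f0 lL) scaler0 subr0.
have BD c u v : B u -> B v -> B (c *: u + v).
  move=> [u' ->] [v' ->]; exists (c *: u' + v'); rewrite lL.
  by rewrite scalerBr scalerDr !scalerA [c * mu]mulrC opprD addrACA.
split=> [|[v ->]].
- apply: (lspan_min (B := B) B0 BD) => {}w [p [v [p0 ->]]].
  have Bi i : B (iter i (act L0) v - mu ^+ i *: v).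
    elim: i => [|i IH] /=; first by rewrite expr0 scale1r subrr.
    set x := iter i _ v in IH *.
    have -> : act L0 x - mu ^+ i.+1 *: v =
        mu *: (x - mu ^+ i *: v) + (act L0 x - mu *: x).
      by rewrite scalerBr scalerA -exprS [RHS]addrC addrA subrK.
    by apply: BD => //; exists x.
  have -> : poly_act p v =
      \sum_(i < size p) p`_i *: (iter i (act L0) v - mu ^+ i *: v).
    under [RHS]eq_bigr do rewrite scalerBr scalerA.
    by rewrite sumrB -scaler_suml -horner_coef p0 scale0r subr0.
  by apply: big_ind => // [x y Bx By|i _]; [rewrite -[x]scale1r | rewrite -[X in B X]addr0];
    apply: BD.
- apply: lspan_sub; exists ('X - mu%:P), v; split.
    by rewrite hornerXsubC subrr.
  rewrite /poly_act size_XsubC !big_ord_recl big_ord0 /= !coefB !coefX !coefC /=.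
  by rewrite sub0r subr0 scale1r addr0 scaleNr addrC.
Qed.

Lemma L0_part : @part _ (sW io) 0 L0.
Proof.
have <- : gdeg io (0 : Gm) = 0 by rewrite /gdeg raddf0.
exact: free_partU.
Qed.

Lemma L0_gen s v : act L0 (act (gen F s : sW io) v) =
  act (gen F s : sW io) (act L0 v) - (io s).1 *: act (gen F s : sW io) v.
Proof.
set e : sW io := gen F s.
have epart : @part _ (sW io) (gdeg io s) e by exact: (free_partU (gdeg io)).
have := act_brk v L0_part epart; rewrite mul0n expr0 scale1r.
have -> : brk L0 e = - (io s).1 *: e.
  rewrite [brk _ _]sW_brkU add0r /sW_const raddf0 /= mul0r sub0r.
  by rewrite if_same.
rewrite (linear_fZ _ _ (act_linl v)) scaleNr => ->.
by rewrite addrC subrK.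
Qed.

Lemma gen_shift mu s v :
  ker_weight (mu + (io s).1) v -> ker_weight mu (act (gen F s : sW io) v).
Proof.
set e : sW io := gen F s.
move=> /ker_weightE [u ->]; apply/ker_weightE; exists (act e u).
rewrite L0_gen -/e addrC -scaleNr (act_linr e) scaleNr scalerDl opprD.
by rewrite [RHS]addrC addrA [RHS]addrAC.
Qed.

Lemma ker_weight_lin mu c u v :
  ker_weight mu u -> ker_weight mu v -> ker_weight mu (c *: u + v).
Proof. exact: lspan_lin. Qed.

Lemma ker_weight_graded mu u v : @part _ M 0 u -> @part _ M 1 v ->
  ker_weight mu (u + v) -> ker_weight mu u /\ ker_weight mu v.
Proof.
move=> u0 v1 /ker_weightE [y].
case: (part_dec y) => -[y0 y1] /= [[p0 p1 ->] _].
have Lp i w : @part _ M i w -> @part _ M i (act L0 w - mu *: w).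
  move=> wi; rewrite addrC -scaleNr; apply: part_lin => //.
  by rewrite -(add0r i); apply: act_part => //; exact: L0_part.
have -> : act L0 (y0 + y1) - mu *: (y0 + y1) =
    (act L0 y0 - mu *: y0) + (act L0 y1 - mu *: y1).
  by rewrite (linear_fD _ _ (act_linr L0)) scalerDr opprD addrACA.
move=> E; have [p [_ puniq]] := part_dec (u + v).
have := puniq (u, v) (And3 u0 v1 erefl).
rewrite (puniq (_, _) (And3 (Lp _ _ p0) (Lp _ _ p1) E)) => -[<- <-].
by split; apply/ker_weightE; [exists y0 | exists y1].
Qed.

Definition ker_pred mu : {pred M} := fun v => `[< ker_weight mu v >].

Lemma ker_pred_closed mu : submod_closed (ker_pred mu).
Proof.
split; first by apply/asboolP; apply: lspan_0.
by move=> c u v /asboolP Hu /asboolP Hv; apply/asboolP; apply: lspan_lin.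
Qed.

HB.instance Definition _ mu :=
  GRing.isSubmodClosed.Build F M (ker_pred mu) (ker_pred_closed mu).

Definition weight_quot mu : lmodType F := quot_space (ker_pred mu).

Definition wcls mu v : weight_quot mu := quot_cls (ker_pred mu) v.

Definition wrepr mu (q : weight_quot mu) : M := quot_repr q.

Lemma wreprK mu (q : weight_quot mu) : wcls mu (wrepr q) = q.
Proof. exact: quot_reprK. Qed.

Lemma wcls_lin mu : linear (wcls mu).
Proof. exact: quot_cls_lin. Qed.

Lemma wcls_eq mu u v : wcls mu u = wcls mu v <-> ker_weight mu (u - v).
Proof.
by apply: (iff_trans (quot_cls_eq _ _ _)); split => [/asboolP|?]; last exact/asboolP.
Qed.

Definition W_space : lmodType F := direct_sum weight_quot.

Definition W_part (i : 'Z_2) : set W_space :=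
  [set w | forall mu, exists2 v, @part _ M i v & (w : dsum weight_quot) mu = wcls mu v].

Lemma W_part_0 i : W_part i 0.
Proof.
by move=> mu; exists 0; [exact: part_0 | rewrite (linear_f0 (wcls_lin _))].
Qed.

Lemma W_part_lin i c (u v : W_space) :
  W_part i u -> W_part i v -> W_part i (c *: u + v).
Proof.
move=> ui vi mu; case: (ui mu) (vi mu) => x xi ux [y yi vy].
by exists (c *: x + y); [exact: part_lin | rewrite dsumZD ux vy wcls_lin].
Qed.

Lemma W_part_dec (w : W_space) : exists! p : W_space * W_space,
  [/\ W_part 0 p.1, W_part 1 p.2 & w = p.1 + p.2].
Proof.
pose d v := projT1 (cid (part_dec v)).
have dP v : [/\ @part _ M 0 (d v).1, @part _ M 1 (d v).2 & v = (d v).1 + (d v).2].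
  by rewrite /d; case: cid => p [].
have dK mu v : ker_weight mu v -> ker_weight mu (d v).1 /\ ker_weight mu (d v).2.
  by case: (dP v) => v0 v1 {1}-> /ker_weight_graded; apply.
pose r mu : M := wrepr ((w : dsum weight_quot) mu).
have rK mu : (w : dsum weight_quot) mu = 0 -> ker_weight mu (r mu).
  move=> w0; rewrite -[r mu]subr0; apply/wcls_eq.
  by rewrite wreprK w0 (linear_f0 (wcls_lin _)).
have wK mu v : ker_weight mu v -> wcls mu v = 0.
  by move=> vK; rewrite -(linear_f0 (wcls_lin mu)); apply/wcls_eq; rewrite subr0.
have [l hl] := dval_fin w.
have h0 : exists l : seq F, forall mu, mu \notin l -> wcls mu (d (r mu)).1 = 0.
  by exists l => mu /hl /rK /dK [? _]; apply: wK.
have h1 : exists l : seq F, forall mu, mu \notin l -> wcls mu (d (r mu)).2 = 0.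
  by exists l => mu /hl /rK /dK [_ ?]; apply: wK.
pose w0 : W_space := DSum h0; pose w1 : W_space := DSum h1.
exists (w0, w1); split=> /=.
  split=> [mu|mu|].
  - by exists (d (r mu)).1 => //; case: (dP (r mu)).
  - by exists (d (r mu)).2 => //; case: (dP (r mu)).
  - apply: dsumP => mu; rewrite -[LHS]wreprK -/(r mu).
    have [_ _ E] := dP (r mu).
    by rewrite {1}E (linear_fD _ _ (wcls_lin mu)).
move=> [a b] /= [a0 b1 wE].
have ab mu : wcls mu (d (r mu)).1 = (a : dsum weight_quot) mu /\
    wcls mu (d (r mu)).2 = (b : dsum weight_quot) mu.
  have [x x0 ax] := a0 mu; have [y y1 bY] := b1 mu.
  have [r0 r1 rE] := dP (r mu).
  have K : ker_weight mu (((d (r mu)).1 - x) + ((d (r mu)).2 - y)).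
    rewrite addrACA -rE -opprD; apply/wcls_eq.
    by rewrite wreprK wE (linear_fD _ _ (wcls_lin mu)) -ax -bY.
  rewrite ax bY; have pB i (u v : M) : part i u -> part i v -> part i (u - v).
    by move=> ui vi; rewrite addrC -scaleN1r; apply: part_lin.
  by case: (ker_weight_graded (pB _ _ _ r0 x0) (pB _ _ _ r1 y1) K) => K0 K1;
    split; apply/wcls_eq.
by congr pair; apply: dsumP => mu; case: (ab mu).
Qed.

Definition W_super : superspace F :=
  @SuperSpace F W_space W_part W_part_0 W_part_lin W_part_dec.

(* gen s has weight - (io s).1 for the adjoint action of L_0 *)
Definition W_op_val (s : Gm) (w : W_super) (nu : F) : weight_quot nu :=
  wcls nu (act (gen F s : sW io)
    (wrepr ((w : dsum weight_quot) (nu + (io s).1)))).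

Lemma W_op_wcls s nu v :
  wcls nu (act (gen F s : sW io) (wrepr (wcls (nu + (io s).1) v))) =
  wcls nu (act (gen F s : sW io) v).
Proof.
apply/wcls_eq; rewrite -(linear_fB _ _ (act_linr (gen F s : sW io))).
by apply: gen_shift; apply/wcls_eq; rewrite wreprK.
Qed.

Lemma W_op_fin s w :
  exists l : seq F, forall nu, nu \notin l -> W_op_val s w nu = 0.
Proof.
have [l hl] := dval_fin w; exists [seq mu - (io s).1 | mu <- l] => nu nul.
rewrite /W_op_val hl; last first.
  by apply: contra nul => nul; apply/mapP; eexists; [exact: nul | rewrite addrK].
rewrite -(linear_f0 (wcls_lin _)) W_op_wcls.
by rewrite (linear_f0 (act_linr _)) (linear_f0 (wcls_lin _)).
Qed.

Definition W_op (s : Gm) (w : W_super) : W_super := DSum (W_op_fin s w).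

Lemma W_opE s (w : W_super) nu :
  (W_op s w : dsum weight_quot) nu = W_op_val s w nu.
Proof. by []. Qed.

Lemma W_op_lin s : linear (W_op s).
Proof.
move=> c u v; apply: dsumP => nu; rewrite dsumZD !W_opE /W_op_val dsumZD.
set x := (u : dsum weight_quot) _; set y := (v : dsum weight_quot) _.
rewrite -[x in LHS]wreprK -[y in LHS]wreprK -wcls_lin W_op_wcls.
by rewrite (act_linr (gen F s : sW io)) wcls_lin.
Qed.

Lemma W_op_part s j (w : W_super) :
  part j w -> part (gdeg io s + j) (W_op s w).
Proof.
move=> wj nu; case: (wj (nu + (io s).1)) => v vj E.
exists (act (gen F s : sW io) v).
  by apply: act_part => //; apply: (free_partU (gdeg io)).
by rewrite W_opE /W_op_val E W_op_wcls.
Qed.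

Lemma W_op_rel s t (w : W_super) : sW_const (io s) (io t) *: W_op (s + t) w =
  W_op s (W_op t w) - (-1) ^+ (gdeg io s * gdeg io t)%N *: W_op t (W_op s w).
Proof.
pose g nu : M := wrepr ((w : dsum weight_quot) nu).
have opE r nu : W_op_val r w nu = wcls nu (act (gen F r : sW io) (g (nu + (io r).1))).
  by [].
have op2 r r' nu : W_op_val r (W_op r' w) nu =
    wcls nu (act (gen F r : sW io) (act (gen F r' : sW io)
      (g (nu + (io r).1 + (io r').1)))).
  by rewrite /W_op_val W_opE opE W_op_wcls.
rewrite [RHS]addrC -scaleNr; apply: dsumP => nu; rewrite dsumZD.
rewrite -[LHS]/(_ *: W_op_val (s + t) w nu) !W_opE !op2 opE.
have E1 : nu + (io (s + t)).1 = nu + (io s).1 + (io t).1.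
  by rewrite raddfD -addrA.
have E2 : nu + (io t).1 + (io s).1 = nu + (io s).1 + (io t).1.
  by rewrite addrAC.
rewrite E1 E2; move: (g _) => x.
have sp r : @part _ (sW io) (gdeg io r) (gen F r) by exact: (free_partU (gdeg io)).
have := act_brk x (sp s) (sp t); rewrite [brk _ _]sW_brkU.
rewrite (linear_fZ _ _ (act_linl x)) => H.
rewrite [RHS]addrC -scaleNr in H.
rewrite -[LHS](linear_fZ _ _ (wcls_lin nu)) H.
exact: wcls_lin.
Qed.

Definition weighting : supermodule (sW io) :=
  module_of_ops W_op_lin W_op_part W_op_rel.

Lemma W_in_fin mu v :
  exists l : seq F, forall nu, nu \notin l ->
    (if nu == mu then wcls nu v else 0) = 0.
Proof. by exists [:: mu] => nu; rewrite inE => /negPf ->. Qed.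

Definition W_in mu v : weighting := DSum (W_in_fin mu v).

Lemma W_in_lin mu : linear (W_in mu).
Proof.
move=> c u v; apply: dsumP => nu; rewrite dsumZD /=.
by case: ifP => _; [exact: wcls_lin | rewrite scaler0 addr0].
Qed.

Lemma ad_L0_coef (x : sW io) s : (brk L0 x)@_s = - (io s).1 * x@_s.
Proof.
have bl := sW_brk_linr io L0.
move: x; apply: malg_lin_ind.
- by rewrite [brk _ _](linear_f0 bl) fcoef0 mulr0.
- move=> c x y Hx Hy; rewrite [brk _ _]bl !fcoefD !fcoefZ Hx Hy.
  by rewrite mulrDr mulrCA.
move=> t; rewrite [brk _ _]sW_brkU add0r fcoefZ fcoefU.
rewrite /sW_const raddf0 /= mul0r sub0r if_same.
by case: eqVneq => [->|_]; rewrite ?mulr0.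
Qed.

(* the defining formula x (v + ker(mu) M) = x v + ker(mu + beta) M for x in the
   root space of beta *)
Lemma W_act_in (x : sW io) (beta mu : F) v :
  brk L0 x = beta *: x -> act x (W_in mu v) = W_in (mu + beta) (act x v).
Proof.
move=> xb; have xs s : s \in msupp x -> (io s).1 = - beta.
  rewrite -mcoeff_neq0 => xs0; have := ad_L0_coef x s.
  by rewrite xb fcoefZ => /(mulIf xs0) ->; rewrite opprK.
have al := act_linl (W_in mu v).
have ar := act_linl v.
move: x xs {xb} => y ys.
apply: (@malg_supp_ind _ _ (fun y : sW io =>
  act y (W_in mu v) = W_in (mu + beta) (act y v))).
- by rewrite (linear_f0 al) (linear_f0 ar) (linear_f0 (W_in_lin _)).
- by move=> c u w Hu Hw; rewrite al ar W_in_lin Hu Hw.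
move=> s /ys sb; rewrite [LHS]ops_actU; apply: dsumP => nu.
rewrite W_opE /W_op_val /= sb.
rewrite subr_eq; case: eqVneq => [->|_].
  by have := W_op_wcls s (mu + beta) v; rewrite sb.
have := W_op_wcls s nu 0; rewrite sb (linear_f0 (wcls_lin _)) => ->.
by rewrite (linear_f0 (act_linr _)) (linear_f0 (wcls_lin _)).
Qed.

End Weighting.

Definition whole_wt (F : fieldType) : {additive subgrp (full_group (wt F)) -> wt F} :=
  incl (full_group (wt F)).

Definition complexes (R : realType) : numFieldType := R[i].

(* Main.v *)
Require Import Defs.
From HB Require Import structures.
From mathcomp Require Import all_boot all_order all_algebra finmap.
From mathcomp Require Import boolp classical_sets reals complex monalg ring.
Import GRing.Theory Num.Theory.
Local Open Scope classical_set_scope.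
Local Open Scope ring_scope.

(** Part (i). [L_0] acts on [sOmega] as multiplication by the variable, because
    [f 0 = 1]; so the quotient at the weight [mu] is two-dimensional, and its two
    coordinates are the values at [mu] of the even and of the odd polynomial
    ([ker_weight_omega]).  In these coordinates a generator of index [s] acts by
    the structure constant of [sV (1 - alpha)] multiplied by [ft s]
    ([omega_eval_act]).  An extension [f] of [ft] to all of [F x Z/2] removes
    this factor: multiply the coordinate of index [k] by [f k], and
    [f (s + k) = f s * f k] turns the twisted action into the untwisted one.
    The extension has to be defined on the whole group since the weights [mu]
    run over the whole field.

    Part (ii). The pair (eigenvalue of [L_0], parity) separates the basis
    vectors of [sV a], so a graded submodule is spanned by the basis vectors
    that it contains ([submodule_supp_in]).  Submodules thus correspond to sets
    of indices closed under the moves [k -> sV_shift s k] with nonzero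
    coefficient.  From any [v_l] every [w_j] is reached, with coefficient [1].
    From [w_j] the vector [v_l] is reached with coefficient
    [j * (2 - 2 * a) + l * (2 * a - 1)].  This is a nonzero function of [l],
    unless [a = 1 / 2] and [j = 0]; and it is a nonzero function of [j], unless
    [a = 1] and [l = 0].  Hence a nonempty closed set is everything, except
    that it can be the single index of [w_0] when [a = 1 / 2], and can miss the
    index of [v_0] when [a = 1] ([move_closed_spread]). *)

(** * Subspaces spanned by basis vectors *)

Section SupportSubspaces.
Set Implicit Arguments.
Unset Strict Implicit.
Variables (F : fieldType) (K : choiceType).
Implicit Types (T : set K) (x : freeMod F K).

Definition supp_in T : set (freeMod F K) :=
  [set x | forall k, x@_k != 0 -> T k].

Lemma supp_in0 T : supp_in T 0.
Proof. by move=> k; rewrite fcoef0 eqxx. Qed.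

Lemma supp_in_lin T c x y :
  supp_in T x -> supp_in T y -> supp_in T (c *: x + y).
Proof.
move=> xT yT k; rewrite fcoefD fcoefZ.
case: (eqVneq y@_k 0) => [->|/yT //].
by rewrite addr0 mulf_eq0 negb_or => /andP[_ /xT].
Qed.

Lemma supp_in_basis T k : supp_in T (basis k) <-> T k.
Proof.
split=> [|Tk l]; first by apply; rewrite fcoefU eqxx oner_neq0.
by rewrite fcoefU; case: (eqVneq k l) => [<- //|_]; rewrite eqxx.
Qed.

Lemma supp_in_sub T (P : set (freeMod F K)) :
  P 0 -> (forall c x y, P x -> P y -> P (c *: x + y)) ->
  (forall k, T k -> P (basis k)) -> supp_in T `<=` P.
Proof.
move=> P0 PD PT x xT; apply: malg_supp_ind => // k.
by rewrite -mcoeff_neq0 => /xT /PT.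
Qed.

Lemma lspan_basis T : lspan (basis @` T) = supp_in T.
Proof.
apply/seteqP; split.
  apply: lspan_min => [|c x y|_ [k Tk <-]]; first exact: supp_in0.
    exact: supp_in_lin.
  exact/supp_in_basis.
apply: supp_in_sub => [|c x y|k Tk]; first exact: lspan_0.
  exact: lspan_lin.
by apply: lspan_sub; exists k.
Qed.

Lemma supp_in_inj : injective supp_in.
Proof.
move=> S T ST; apply/funext => k; apply/propext.
by rewrite -supp_in_basis ST supp_in_basis.
Qed.

Lemma supp_in_set0 : supp_in set0 = [set 0].
Proof.
apply/seteqP; split=> x; last by move=> ->; apply: supp_in0.
move=> x0; apply/malgP => k; rewrite fcoef0; apply/eqP.
by case: (boolP (_ == 0)) => // /x0.
Qed.

Lemma supp_in_setT : supp_in setT = setT.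
Proof. by apply/seteqP. Qed.

(** The product of the [D - mu], over the eigenvalues [mu] other than [h k] that
    occur in [x], kills every coordinate of [x] with another eigenvalue and
    multiplies the coordinate at [k] by a nonzero number.  What is left lives on
    the indices with eigenvalue [h k], and its part of degree [deg k] is a
    multiple of the basis vector at [k]. *)
Lemma diag_stable_basis (deg : K -> 'Z_2) (h : K -> F)
    (D : freeMod F K -> freeMod F K) (N : set (freeMod F K)) :
  (forall k l, h k = h l -> deg k = deg l -> k = l) ->
  (forall x k, (D x)@_k = h k * x@_k) ->
  (forall c x y, N x -> N y -> N (c *: x + y)) -> N 0 ->
  (forall x y, free_part deg 0 x -> free_part deg 1 y ->
    N (x + y) -> N x /\ N y) ->
  (forall x, N x -> N (D x)) ->
  forall x k, N x -> x@_k != 0 -> N (basis k).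
Proof.
move=> hdeg DE NL N0 Ngr ND x k Nx xk.
have filterN (s : seq F) : exists2 y, N y &
    forall l, y@_l = (\prod_(mu <- s) (h l - mu)) * x@_l.
  elim: s => [|mu s [y Ny yE]].
    by exists x => // l; rewrite big_nil mul1r.
  exists (- mu *: y + D y); first by apply: NL => //; apply: ND.
  by move=> l; rewrite fcoefD fcoefZ DE yE big_cons; ring.
have [y Ny yE] := filterN [seq h l | l <- msupp x & h l != h k].
have y0 l : h l != h k -> y@_l = 0.
  move=> lk; rewrite yE; have [xl|] := boolP (l \in msupp x); last first.
    by rewrite -mcoeff_eq0 => /eqP ->; rewrite mulr0.
  rewrite (big_rem (h l)) /= ?subrr ?mul0r //.
  by apply/mapP; exists l => //; rewrite mem_filter lk.
have yk : y@_k != 0.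
  rewrite yE mulf_neq0 // prodf_seq_neq0; apply/allP => _ /mapP[l + ->] /=.
  by rewrite mem_filter subr_eq0 eq_sym => /andP[].
have [[u v] /= [[u0 v1 yuv] _]] := free_part_dec deg y.
have [Nu Nv] : N u /\ N v by apply: Ngr => //; rewrite -yuv.
have [z [Nz zdeg zE]] : exists z, [/\ N z, free_part deg (deg k) z &
    forall l, deg l = deg k -> z@_l = y@_l].
  move: u0 v1 => /free_partP u0 /free_partP v1.
  case: (Z2P (deg k)) => ->; [exists u | exists v]; split=> //;
    try exact/free_partP; move=> l lk; rewrite yuv fcoefD.
    by rewrite [v@_l]v1 ?addr0 ?lk.
  by rewrite [u@_l]u0 ?add0r ?lk.
suff -> : basis k = (y@_k)^-1 *: z + 0 by apply: NL.
apply/malgP => l; rewrite addr0 fcoefZ fcoefU.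
case: (eqVneq k l) => [<-|kl]; first by rewrite zE // mulVf.
have [lk|lk] := eqVneq (deg l) (deg k); last first.
  by move/free_partP: zdeg => ->; rewrite ?mulr0.
rewrite zE // [y@_l]y0 ?mulr0 //.
by apply: contra kl => /eqP hl; apply/eqP/hdeg.
Qed.

End SupportSubspaces.

(** * Graded submodules of the intermediate series *)

Section SubmodulesOfIntermediateSeries.
Set Implicit Arguments.
Unset Strict Implicit.
Variables (F : numFieldType) (a : F).
Local Notation V := (sV (whole_wt F) a).
Implicit Types (T : set (wt F)) (N : set V) (k s : wt F).

(** The index sets whose basis vectors span a submodule: [sV_coef a s k] is the
    coefficient with which the generator of index [s] sends the basis vector at
    [k] to the one at [sV_shift s k]. *)
Definition move_closed T : Prop :=
  forall s k, T k -> sV_coef a s k != 0 -> T (sV_shift s k).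

Lemma whole_wt_surj s : exists t, whole_wt F t = s.
Proof. by exists (exist _ s isT). Qed.

Lemma sV_act_gen (Gm : zmodType) (io : {additive Gm -> wt F}) t k :
  act (gen F t : sW io) (basis k : sV io a) =
  sV_coef a (io t) k *: (basis (sV_shift (io t) k) : sV io a).
Proof. by rewrite [LHS]ops_actU [LHS]sV_opU. Qed.

Lemma supp_in_submodule T : move_closed T -> graded_submodule V (supp_in T).
Proof.
move=> Tcl; split; first exact: supp_in0.
- by move=> c u v; exact: supp_in_lin.
- move=> u v /free_partP u0 /free_partP v1 uvT; split=> k kn0.
    apply: uvT; rewrite fcoefD [v@_k]v1 ?addr0 //.
    by case: (Z2P k.2) kn0 => k2; rewrite /sV_deg k2 // u0 /sV_deg ?k2 ?eqxx.
  apply: uvT; rewrite fcoefD [u@_k]u0 ?add0r //.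
  by case: (Z2P k.2) kn0 => k2; rewrite /sV_deg k2 // v1 /sV_deg ?k2 ?eqxx.
- move=> x v vT; apply: (malg_lin_ind (P := fun x : sW _ => supp_in T (act x v))).
  + by rewrite (linear_f0 (act_linl v)); apply: supp_in0.
  + by move=> c y z yT zT; rewrite act_linl; apply: supp_in_lin.
  move=> t; apply: (supp_in_sub (P := fun v => supp_in T (act (gen F t : sW _) (v : V)))) vT.
  + by rewrite (linear_f0 (act_linr _)); apply: supp_in0.
  + by move=> c y z yT zT; rewrite act_linr; apply: supp_in_lin.
  move=> k Tk; rewrite sV_act_gen => l.
  rewrite fcoefZ fcoefU mulf_eq0 negb_or => /andP[c0].
  by case: (eqVneq _ l) => [<- _|_]; [apply: Tcl | rewrite eqxx].
Qed.

(** As [Z/2] has characteristic two, [io t + k] is the only index that the shift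
    by [io t] sends to [k]. *)
Lemma sV_op_coef (Gm : zmodType) (io : {additive Gm -> wt F}) t
    (v : freeMod F (wt F)) k :
  (sV_op io a t v : freeMod F (wt F))@_k =
  sV_coef a (io t) (io t + k) * v@_(io t + k).
Proof.
set f : freeMod F (wt F) -> freeMod F (wt F) := sV_op io a t.
have fl : linear f by exact: sV_op_lin.
have fU l : f (basis l) = sV_coef a (io t) l *: basis (sV_shift (io t) l).
  exact: sV_opU.
clearbody f; move: v; apply: malg_lin_ind.
- by rewrite (linear_f0 fl) !fcoef0 mulr0.
- by move=> c x y Hx Hy; rewrite fl !fcoefD !fcoefZ Hx Hy mulrDr mulrCA.
move=> l; rewrite fU fcoefZ !fcoefU.
have -> : (sV_shift (io t) l == k) = (l == io t + k).
  rewrite /sV_shift; case: (io t) l k => [m i] [l j] [k p].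
  rewrite !xpair_eqE /= subr_eq addrC; congr (_ && _).
  by case: (Z2P i) => ->; case: (Z2P j) => ->; case: (Z2P p) => ->.
by case: (eqVneq l) => [->|_]; rewrite ?mulr0.
Qed.

Lemma act_L0_coef (v : V) k : (act (L0 (whole_wt F)) v : V)@_k = k.1 * v@_k.
Proof.
rewrite [act _ _]ops_actU sV_op_coef raddf0 add0r /sV_coef /= !mulr0 !subr0.
by rewrite if_same.
Qed.

Lemma submodule_basis N (x : V) k :
  graded_submodule V N -> N x -> x@_k != 0 -> N (basis k).
Proof.
move=> [N0 NL Ngr Nact].
apply: (diag_stable_basis (deg := @sV_deg F) (h := fst)
          (D := act (L0 (whole_wt F)) : V -> V)) => //.
- by move=> [k1 k2] [l1 l2] /= -> ->.
- by move=> y l; exact: act_L0_coef.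
- by move=> y; apply: Nact.
Qed.

Lemma submodule_supp_in N : graded_submodule V N ->
  exists2 T, move_closed T & N = supp_in T.
Proof.
move=> Nsub; have [N0 NL _ Nact] := Nsub.
exists [set k | N (basis k)] => /=.
  move=> s k Nk c0; have [t tE] := whole_wt_surj s.
  apply: (submodule_basis (x := act (gen F t : sW _) (basis k : V))) => //.
    exact: Nact.
  by rewrite sV_act_gen fcoefZ fcoefU tE eqxx mulr1.
apply/seteqP; split=> [x Nx k|]; first exact: submodule_basis.
exact: supp_in_sub.
Qed.

(** The move is by [G_(l - j)], which acts on [v_l] with coefficient [1]. *)
Lemma move_closed_even T l :
  move_closed T -> T (l, 0) -> forall j, T (j, 1).
Proof.
move=> Tcl Tl j; have := Tcl (l - j, 1) _ Tl; rewrite /sV_coef /sV_shift /=.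
by rewrite subKr addr0; apply; exact: oner_neq0.
Qed.

(** The displayed scalar is the coefficient of [G_(j - l)] from [w_j] to [v_l]. *)
Lemma move_closed_odd T j l : move_closed T -> T (j, 1) ->
  j * (2 - 2 * a) + l * (2 * a - 1) != 0 -> T (l, 0).
Proof.
move=> Tcl Tj c0; have := Tcl (j - l, 1) _ Tj; rewrite /sV_coef /sV_shift /=.
rewrite subKr (_ : 1 + 1 = 0 :> 'Z_2); last exact: val_inj.
apply; suff -> : j - 2 * (j - l) * (a - 1 / 2) =
  j * (2 - 2 * a) + l * (2 * a - 1) by [].
by field.
Qed.

(** The coefficient in [move_closed_odd] is affine in [l], and affine in [j], so
    when it is not identically zero it is nonzero at [0] or at [1].  With [j]
    fixed this leads from [w_j] to some [v_l], from there to all [w_j], and with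
    [l] fixed from some [w_j] to a prescribed [v_l]. *)
Lemma move_closed_spread T k k' : move_closed T -> T k ->
  a != 1 / 2 \/ k != (0, 1) -> a != 1 \/ k' != (0, 0) -> T k'.
Proof.
move=> Tcl Tk ka k'a.
have two0 : (2 : F) != 0 by rewrite pnatr_eq0.
have [l Tl] : exists l, T (l, 0).
  case: k Tk ka => j i; case: (Z2P i) => -> Tj ja; first by exists j.
  have [j0|j0] := eqVneq (j * (2 - 2 * a)) 0; last first.
    by exists 0; apply: (move_closed_odd Tcl Tj); rewrite mul0r addr0.
  exists 1; apply: (move_closed_odd Tcl Tj); rewrite j0 add0r mul1r.
  apply/eqP => a1; have aE : a = 1 / 2.
    by apply: (mulfI two0); apply/eqP; rewrite -subr_eq0 mulrCA mul1r divff // a1.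
  case: ja => [|/eqP]; first by rewrite aE eqxx.
  apply; congr (_, _); move: j0; rewrite aE (_ : 2 - 2 * (1 / 2) = 1); last by field.
  by rewrite mulr1.
have Todd := move_closed_even Tcl Tl.
case: k' k'a => l' i; case: (Z2P i) => -> l'a; last exact: Todd.
have [l0|l0] := eqVneq (l' * (2 * a - 1)) 0; last first.
  by apply: (move_closed_odd Tcl (Todd 0)); rewrite mul0r add0r.
apply: (move_closed_odd Tcl (Todd 1)); rewrite l0 addr0 mul1r.
rewrite -{1}[2]mulr1 -mulrBr mulf_neq0 // subr_eq0 eq_sym.
apply/eqP => a1; case: l'a => [|/eqP]; first by rewrite a1 eqxx.
apply; congr (_, _); move: l0; rewrite a1 (_ : 2 * 1 - 1 = 1); last by ring.
by rewrite mulr1.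
Qed.

Lemma unique_proper_supp_in T0 : move_closed T0 ->
  T0 <> set0 -> T0 <> setT ->
  (forall T, move_closed T -> [\/ T = set0, T = T0 | T = setT]) ->
  unique_proper_submodule V (supp_in T0).
Proof.
move=> T0cl T00 T0T cases N; split=> [[Nsub N0 NT]|->].
  have [T Tcl NE] := submodule_supp_in Nsub.
  case: (cases T Tcl) => TE; rewrite NE TE // in N0 NT *.
    by rewrite supp_in_set0 in N0.
  by rewrite supp_in_setT in NT.
split; first exact: supp_in_submodule.
  by rewrite -[RHS]/([set (0 : freeMod F (wt F))]) -supp_in_set0 => /supp_in_inj.
by rewrite -[RHS]/[set: freeMod F (wt F)] -supp_in_setT => /supp_in_inj.
Qed.

Lemma unique_proper_not_simple N0 :
  unique_proper_submodule V N0 -> ~ simple_module V.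
Proof.
move=> /(_ N0) [_ /(_ erefl)] [N0sub N00 N0T] [_ /(_ _ N0sub)].
by case.
Qed.

Lemma sV_simple : a <> 1 / 2 -> a <> 1 -> simple_module V.
Proof.
move=> /eqP a12 /eqP a1; split.
  exists (sV_v (0 : F)) => /(congr1 (mcoeff ((0, 0) : wt F))).
  by rewrite [LHS]fcoefU eqxx [RHS]fcoef0 => /eqP; rewrite oner_eq0.
move=> N /submodule_supp_in [T Tcl ->].
have [->|/set0P[k Tk]] := eqVneq T set0; first by left; exact: supp_in_set0.
right; suff -> : T = setT by exact: supp_in_setT.
by apply/seteqP; split=> // l _; apply: (move_closed_spread Tcl Tk); left.
Qed.

End SubmodulesOfIntermediateSeries.

(** * The two reducible intermediate series *)

Section SpecialParameters.
Variable F : numFieldType.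

Lemma half_neq1 : 1 / 2 != 1 :> F.
Proof.
rewrite -subr_eq0 (_ : 1 / 2 - 1 = - 2^-1); last by field.
by rewrite oppr_eq0 invr_eq0 pnatr_eq0.
Qed.

(** Out of [w_j] the move by [L_m] has coefficient [j - (a - 1 / 2) * m] and the
    one by [G_r] has [j - 2 * r * (a - 1 / 2)]; both vanish for [j = 0], so [w_0]
    spans a submodule. *)
Lemma sV_half_unique_proper :
  unique_proper_submodule (sV (whole_wt F) (1 / 2)) (lspan [set sV_w (0 : F)]).
Proof.
have -> : [set sV_w (0 : F)] = basis @` [set ((0, 1) : wt F)].
  by rewrite image_set1.
rewrite [X in unique_proper_submodule _ X](lspan_basis F [set ((0, 1) : wt F)]).
apply: unique_proper_supp_in.
- move=> [m i] k ->; rewrite /sV_coef /sV_shift /=.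
  by rewrite subrr mul0r mulr0 subr0 if_same eqxx.
- by move/seteqP => [/(_ (0, 1)) /(_ erefl)].
- by move/seteqP => [_ /(_ (0, 0) I)].
move=> T Tcl; have [[k [Tk k0]]|noT] := pselect (exists k, T k /\ k != (0, 1)).
  apply: Or33; apply/seteqP; split=> // l _.
  apply: (move_closed_spread Tcl Tk); first by right.
  by left; exact: half_neq1.
have Tsub k : T k -> k = (0, 1).
  by move=> Tk; apply: contrapT => /eqP k0; apply: noT; exists k.
have [T0|nT0] := pselect (T (0, 1)).
  by apply: Or32; apply/seteqP; split=> k => [/Tsub|->].
by apply: Or31; apply/seteqP; split=> // k Tk; apply: nT0; rewrite -(Tsub k Tk).
Qed.

(** The moves that end at [v_0] are those by [L_m] from [v_m], with coefficient
    [m - m], and those by [G_r] from [w_r], with coefficient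
    [r - 2 * r * (1 / 2)]; so the basis vectors other than [v_0] span a
    submodule. *)
Lemma sV_one_unique_proper :
  unique_proper_submodule (sV (whole_wt F) 1)
    (lspan ([set sV_v k | k in [set k : F | k <> 0]] `|` range (@sV_w F))).
Proof.
have -> : [set sV_v k | k in [set k : F | k <> 0]] `|` range (@sV_w F) =
    basis @` [set k : wt F | k <> (0, 0)].
  apply/seteqP; split=> x.
    by move=> [[k /= k0 <-]|[k _ <-]]; [exists (k, 0) => // -[] | exists (k, 1)].
  move=> [[k i] + <-]; case: (Z2P i) => -> /= k0; last by right; exists k.
  by left; exists k => // kE; apply: k0; rewrite kE.
rewrite [X in unique_proper_submodule _ X](lspan_basis F [set k : wt F | k <> (0, 0)]).
apply: unique_proper_supp_in.
- move=> [m i] [k j] /= _ c0 [km ij]; move: c0; rewrite /sV_coef /=.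
  move/eqP: km; rewrite subr_eq0 => /eqP ->.
  case: (Z2P i) ij => ->; case: (Z2P j) => -> //= _; rewrite ?mul1r ?subrr ?eqxx //.
  by rewrite (_ : m - 2 * m * (1 - 2^-1) = 0) ?eqxx //; field.
- by move/seteqP => [/(_ (0, 1)) h _]; case: h.
- by move/seteqP => [_ /(_ (0, 0) I)] h; case: h.
move=> T Tcl; have [[k Tk]|noT] := pselect (exists k, T k); last first.
  by apply: Or31; apply/seteqP; split=> // k Tk; apply: noT; exists k.
have Tsup l : l <> (0, 0) -> T l.
  move=> /eqP l0; apply: (move_closed_spread Tcl Tk); last by right.
  by left; rewrite eq_sym half_neq1.
have [T0|nT0] := pselect (T (0, 0)); [apply: Or33 | apply: Or32].
  apply/seteqP; split=> // l _.
  by have [->//|/eqP/Tsup] := eqVneq l (0, 0).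
by apply/seteqP; split=> // l Tl lE; apply: nT0; rewrite -lE.
Qed.

End SpecialParameters.

(** * The weighting of the module of polynomials *)

Section WeightingOmega.
Set Implicit Arguments.
Unset Strict Implicit.
Variables (F : numFieldType) (Gm : zmodType) (io : {additive Gm -> wt F}).
Variables (ft : character F Gm) (f : character F (wt F)) (al : F).
Hypothesis f_ext : forall s, f (io s) = ft s.
Local Notation M := (sOmega io ft al).
Local Notation W := (weighting M).
Local Notation S := (sV io (1 - al)).
Implicit Types (v : M) (w : W) (k : wt F) (mu : F).

Lemma character0 : f 0 = 1.
Proof.
by apply: (mulfI (chi_neq0 f 0)); rewrite -chiD addr0 mulr1.
Qed.

Definition omega_comp (i : 'Z_2) (v : {poly F} * {poly F}) : {poly F} :=
  if i == 0 then v.1 else v.2.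

Lemma omega_comp_lin i : linear (omega_comp i : omega_space F -> {poly F}).
Proof. by move=> c u v; rewrite /omega_comp; case: ifP. Qed.

Lemma act_omega (s : Gm) v : act (gen F s : sW io) v = omega_op io ft al s v.
Proof. exact: ops_actU. Qed.

Definition omega_eval k (v : {poly F} * {poly F}) : F :=
  (omega_comp k.2 v).[k.1].

Lemma omega_eval_lin k c (u v : omega_space F) :
  omega_eval k (c *: u + v : omega_space F) = c * omega_eval k u + omega_eval k v.
Proof. by rewrite /omega_eval omega_comp_lin hornerD hornerZ. Qed.

Lemma omega_evalB k (u v : M) :
  omega_eval k (u - v : M) = omega_eval k u - omega_eval k v.
Proof.
have -> : (u - v : M) = (-1 *: v + u : omega_space F) by rewrite scaleN1r addrC.
by rewrite omega_eval_lin mulN1r addrC.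
Qed.

(** The new polynomials are evaluated at [k.1], the old ones at the shifted point
    [k.1 + m], which is the weight that the action starts from.  In terms of that
    weight the factor [k.1 + m * al] is [(k.1 + m) - (1 - al) * m]: this is where
    the parameter [1 - al] comes from. *)
Lemma omega_eval_act (s : Gm) v k :
  omega_eval k (act (gen F s : sW io) v : M) =
  ft s * sV_coef (1 - al) (io s) (io s + k) * omega_eval (io s + k) v.
Proof.
rewrite act_omega; case: v => P Q; rewrite /omega_op /gdeg /omega_eval /omega_comp /sV_coef.
case: (io s) k => m i [k j] /=.
by case: (Z2P i) => ->; case: (Z2P j) => -> /=;
  rewrite !(hornerZ, hornerM, hornerD, hornerX, hornerC, horner_comp) [k + m]addrC;
  field.
Qed.

(** [ker_weight mu] is the image of [L_0 - mu], which acts as multiplication by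
    ['X - mu%:P] on both polynomials; the factor theorem describes its image. *)
Lemma ker_weight_omega mu v :
  ker_weight mu v <-> forall i, omega_eval (mu, i) v = 0.
Proof.
have L0E (u : {poly F} * {poly F}) :
    act (L0 io) (u : M) = (('X * u.1, 'X * u.2) : omega_space F).
  rewrite act_omega /omega_op; case: u => P Q; rewrite /gdeg raddf0 /=.
  by rewrite !mul0r !addr0 !comp_polyXr -f_ext raddf0 character0 !scale1r.
split=> [/ker_weightE [u ->] i|v0].
  rewrite L0E /omega_eval /omega_comp /=; case: u => P Q /=.
  by case: ifP => _; rewrite !hornerE subrr.
apply/ker_weightE; case: v v0 => P Q v0.
have /factor_theorem [P' ->] : root P mu by apply/rootP; exact: (v0 0).
have /factor_theorem [Q' ->] : root Q mu by apply/rootP; exact: (v0 1).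
exists (P', Q'); rewrite L0E /=; congr (_, _) => /=; rewrite -mul_polyC; ring.
Qed.

Lemma omega_eval_wcls k v : omega_eval k (wrepr (wcls k.1 v)) = omega_eval k v.
Proof.
have /wcls_eq/ker_weight_omega/(_ k.2) : wcls k.1 (wrepr (wcls k.1 v)) = wcls k.1 v.
  by rewrite wreprK.
by rewrite -surjective_pairing omega_evalB => /eqP; rewrite subr_eq0 => /eqP.
Qed.

Definition W_eval w k : F :=
  omega_eval k (wrepr ((w : dsum (weight_quot M)) k.1)).

Lemma W_eval_lin k c (u w : W) : W_eval (c *: u + w) k = c * W_eval u k + W_eval w k.
Proof.
rewrite /W_eval dsumZD; move: (dval u _) (dval w _) => p q.
by rewrite -{1}[p]wreprK -{1}[q]wreprK -wcls_lin omega_eval_wcls omega_eval_lin.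
Qed.

Lemma W_eval_inj u w : W_eval u =1 W_eval w -> u = w.
Proof.
move=> uw; apply: dsumP => mu; rewrite -[LHS]wreprK -[RHS]wreprK.
apply/wcls_eq/ker_weight_omega => i; have := uw (mu, i); rewrite /W_eval /=.
move: (wrepr _) (wrepr _) => p q pq.
by rewrite omega_evalB pq subrr.
Qed.

Lemma W_eval_act (s : Gm) w k : W_eval (act (gen F s : sW io) w : W) k =
  ft s * sV_coef (1 - al) (io s) (io s + k) * W_eval w (io s + k).
Proof.
rewrite {1}/W_eval [act _ _]ops_actU W_opE /W_op_val omega_eval_wcls.
by rewrite omega_eval_act [k.1 + _]addrC.
Qed.

Lemma W_eval_part i w k : @part _ W i w -> k.2 != i -> W_eval w k = 0.
Proof.
move=> wi ki; case: (wi k.1) => v vi; rewrite /W_eval => ->.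
rewrite omega_eval_wcls; move: v vi ki => [P Q] /=.
rewrite /omega_part /omega_eval /omega_comp.
by case: (Z2P i) => ->; case: (Z2P k.2) => -> //= ->; rewrite horner0.
Qed.

Lemma W_eval_surj (c : freeMod F (wt F)) : exists w, forall k, W_eval w k = c@_k / f k.
Proof.
pose d k := c@_k / f k.
pose v mu : M := (((d (mu, 0))%:P, (d (mu, 1))%:P) : omega_space F).
have fin : exists l : seq F, forall mu, mu \notin l -> wcls mu (v mu) = 0.
  exists [seq k.1 | k <- msupp c] => mu mul.
  have d0 i : d (mu, i) = 0.
    rewrite /d mcoeff_outdom ?mul0r //; apply: contra mul => kc.
    by apply/mapP; exists (mu, i).
  by rewrite /v !d0 polyC0 (linear_f0 (wcls_lin _)).
exists (DSum fin) => k; rewrite /W_eval /= omega_eval_wcls.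
rewrite /omega_eval /omega_comp; case: k => k i /=.
by case: (Z2P i) => ->; rewrite /= hornerC.
Qed.

Lemma W_eval_fin w : exists x : freeMod F (wt F), forall k, x@_k = f k * W_eval w k.
Proof.
have [l hl] := dval_fin w.
pose D := [fset k in [seq ((mu, i) : wt F) | mu <- l, i <- [:: 0; 1]]]%fset.
exists [malg k in D => f k * W_eval w k] => k; rewrite mcoeffE.
case: ifP => // /negP kD; rewrite /W_eval hl.
  rewrite -(linear_f0 (wcls_lin _)) omega_eval_wcls.
  by rewrite /omega_eval /omega_comp; case: ifP => _; rewrite horner0 mulr0.
apply/negP => kl; apply: kD; rewrite inE; apply/allpairsP; exists k => /=.
by rewrite kl; case: k {kl} => k i /=; case: (Z2P i) => ->.
Qed.

(** The isomorphism onto [sV]: the weight spaces are read off in the values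
    [W_eval], and the factor [f k] absorbs the [ft s] of [W_eval_act]. *)
Definition W_coords w : freeMod F (wt F) := projT1 (cid (W_eval_fin w)).

Lemma W_coordsE w k : (W_coords w)@_k = f k * W_eval w k.
Proof. by rewrite /W_coords; case: cid. Qed.

Lemma W_coords_lin : linear (W_coords : W -> S).
Proof.
move=> c u w; apply/malgP => k.
rewrite [RHS]fcoefD [X in _ = X + _]fcoefZ !W_coordsE W_eval_lin.
by rewrite mulrDr mulrCA.
Qed.

Lemma weighting_sOmega : module_iso W S.
Proof.
pose L := GRing.isLinear.Build F W S *:%R W_coords W_coords_lin.
pose phi : {linear W -> S} := HB.pack W_coords L.
exists phi; split.
- have [psi psiE] := choice W_eval_surj.
  exists psi => [w|x].
    apply: W_eval_inj => k; rewrite psiE W_coordsE mulrC mulKf //.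
    exact: chi_neq0.
  by apply/malgP => k; rewrite W_coordsE psiE mulrC divfK // chi_neq0.
- move=> i w wi; apply/free_partP => k ki.
  by rewrite W_coordsE (W_eval_part wi ki) mulr0.
move=> x w; suff : W_coords (act x w) = act x (W_coords w : S) by [].
have Wl := act_linl w; have Sl := act_linl (W_coords w : S).
move: x; apply: malg_lin_ind.
- by rewrite (linear_f0 Wl) (linear_f0 Sl) (linear_f0 W_coords_lin).
- by move=> c x y Hx Hy; rewrite Wl Sl W_coords_lin Hx Hy.
move=> s; apply/malgP => k; rewrite W_coordsE W_eval_act.
rewrite [act _ _]ops_actU sV_op_coef W_coordsE chiD f_ext; ring.
Qed.

End WeightingOmega.

(** * Complex coefficients *)

Theorem theorem5p2 (R : realType) :
  (forall (Gamma : zmodClosed (wt (complexes R))) (alpha : complexes R)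
      (ft : character (complexes R) (subgrp Gamma))
      (f : character (complexes R) (wt (complexes R))),
    (forall x : subgrp Gamma, f (incl Gamma x) = ft x) ->
    module_iso (weighting (sOmega (incl Gamma) ft alpha))
               (sV (incl Gamma) (1 - alpha))) /\
  (forall alpha : complexes R,
    simple_module (sV (whole_wt (complexes R)) alpha) <->
    (alpha <> 1 / 2 /\ alpha <> 1)) /\
  unique_proper_submodule (sV (whole_wt (complexes R)) (1 / 2))
    (lspan [set sV_w (0 : complexes R)]) /\
  unique_proper_submodule (sV (whole_wt (complexes R)) 1)
    (lspan ([set sV_v k | k in [set k : complexes R | k <> 0]] `|`
           range (@sV_w (complexes R)))).
Proof.
split; [|split; [|split]].
- by move=> Gamma alpha ft f f_ext; apply: (weighting_sOmega (f := f)).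
- move=> alpha; split=> [simple|[a12 a1]]; last exact: sV_simple.
  split=> aE; move: simple; rewrite aE.
    exact: (unique_proper_not_simple (@sV_half_unique_proper _)).
  exact: (unique_proper_not_simple (@sV_one_unique_proper _)).
- exact: sV_half_unique_proper.
- exact: sV_one_unique_proper.
Qed.
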